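(* For an arbitrary finitely generated Abelian group $A$, the wreath product $A\wr\mathbb{Z}$ is not almost polycyclic.
   Context: Wreath product: for a group $A$, $A\wr\mathbb{Z} := \left(\bigoplus_{i\in\mathbb{Z}}A_i\right)\rtimes\mathbb{Z}$, where each $A_i$ is a copy of $A$ and $n\in\mathbb{Z}$ acts on $\bigoplus_{i\in\mathbb{Z}} A_i$ by the shift taking $A_i$ identically onto $A_{n+i}$. A group $G$ is polycyclic if there is a finite sequence of subgroups $\{e\}=G_0\lhd G_1\lhd\cdots\lhd G_k=G$ such that every quotient $G_{i+1}/G_i$ is cyclic. A group is almost polycyclic if it contains a polycyclic subgroup of finite index.
   Formalization: The group A is assumed nontrivial: for trivial A the wreath product is isomorphic to the integers, which is polycyclic, so the claim fails in that single case. *)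

(* Defs.v *)
From HB Require Import structures.
From mathcomp Require Import all_boot all_order all_algebra.
From mathcomp Require Import finmap.
From mathcomp Require Import boolp classical_sets functions cardinality.

Set Implicit Arguments.
Unset Strict Implicit.
Unset Printing Implicit Defensive.

Import GRing.Theory.

Local Open Scope classical_set_scope.
Local Open Scope group_scope.

(* The library's [group_closed] concerns boolean predicates; subgroups of
   possibly infinite groups are taken here as arbitrary [Prop]-valued sets. *)
Section Subgroups.
Variable G : groupType.
Implicit Types (H K P : set G) (x y : G).

Definition subgroup H : Prop :=
  [/\ H 1, forall x y, H x -> H y -> H (x * y) & forall x, H x -> H x^-1].

Definition generated (X : set G) : set G := smallest subgroup X.

Definition finitely_generated : Prop :=
  exists s : seq G, generated [set` s] = [set: G].

Definition normal_in H K : Prop :=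
  [/\ subgroup H, subgroup K, H `<=` K & forall x y, H x -> K y -> H (x ^ y)].

Definition lcoset H x : set G := [set x * h | h in H].

Definition quotient K H : set (set G) := [set lcoset H x | x in K].

Definition expgz x (n : int) : G :=
  match n with Posz m => x ^+ m | Negz m => x ^- m.+1 end.

(* Used only when H is normal in K; then (xH)^n = x^n H, so the right-hand
   side is the cyclic subgroup of K / H generated by the coset xH. *)
Definition cyclic_quotient K H : Prop :=
  exists2 x, K x & quotient K H = [set lcoset H (expgz x n) | n in [set: int]].

Definition polycyclic P : Prop :=
  exists (k : nat) (S : nat -> set G),
    [/\ S 0%N = [set 1], S k = P &
        forall i, (i < k)%N ->
          normal_in (S i) (S i.+1) /\ cyclic_quotient (S i.+1) (S i)].

Definition finite_index H : Prop := finite_set (quotient [set: G] H).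

Definition almost_polycyclic : Prop :=
  exists P : set G, [/\ subgroup P, polycyclic P & finite_index P].

End Subgroups.

Arguments finitely_generated : clear implicits.
Arguments almost_polycyclic : clear implicits.

(* The restricted direct sum of copies of A indexed by the integers: finitely
   supported functions, with pointwise operations. *)
Definition dsumZ (A : groupType) := {fsfun int -> A with 1}.

Section DirectSum.
Variable A : groupType.
Implicit Types f g h : dsumZ A.

HB.instance Definition _ := Choice.on (dsumZ A).

Definition dsum_one : dsumZ A := [fsfun].
Definition dsum_mul f g : dsumZ A :=
  [fsfun i in (finsupp f `|` finsupp g)%fset => f i * g i].
Definition dsum_inv f : dsumZ A := [fsfun i in finsupp f => (f i)^-1].

Lemma dsum_oneE i : dsum_one i = 1.
Proof. by rewrite /dsum_one fsfunE. Qed.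

Lemma dsum_mulE f g i : dsum_mul f g i = f i * g i.
Proof.
rewrite /dsum_mul fsfunE in_fsetU.
by do 2![case: finsuppP => ? //=]; rewrite mulg1.
Qed.

Lemma dsum_invE f i : dsum_inv f i = (f i)^-1.
Proof. by rewrite /dsum_inv fsfunE; case: finsuppP => // _; rewrite invg1. Qed.

Fact dsum_mulA : associative dsum_mul.
Proof. by move=> f g h; apply/fsfunP => i; rewrite !dsum_mulE mulgA. Qed.
Fact dsum_mul1 : left_id dsum_one dsum_mul.
Proof. by move=> f; apply/fsfunP => i; rewrite dsum_mulE dsum_oneE mul1g. Qed.
Fact dsum_mulr1 : right_id dsum_one dsum_mul.
Proof. by move=> f; apply/fsfunP => i; rewrite dsum_mulE dsum_oneE mulg1. Qed.
Fact dsum_mulV : left_inverse dsum_one dsum_inv dsum_mul.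
Proof.
by move=> f; apply/fsfunP => i; rewrite dsum_mulE dsum_invE dsum_oneE mulVg.
Qed.
Fact dsum_mulrV : right_inverse dsum_one dsum_inv dsum_mul.
Proof.
by move=> f; apply/fsfunP => i; rewrite dsum_mulE dsum_invE dsum_oneE mulgV.
Qed.

HB.instance Definition _ := isGroup.Build (dsumZ A)
  dsum_mulA dsum_mul1 dsum_mulr1 dsum_mulV dsum_mulrV.

Lemma dsumZ1E i : (1 : dsumZ A) i = 1. Proof. exact: dsum_oneE. Qed.
Lemma dsumZME f g i : (f * g) i = f i * g i. Proof. exact: dsum_mulE. Qed.
Lemma dsumZVE f i : f^-1 i = (f i)^-1. Proof. exact: dsum_invE. Qed.

(* The shift by n carries the copy of A of index i onto that of index n + i. *)
Definition shift (n : int) f : dsumZ A :=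
  [fsfun i in [fset (n + j)%R | j in finsupp f]%fset => f (i - n)%R].

Lemma shiftE n f i : shift n f i = f (i - n)%R.
Proof.
rewrite /shift fsfunE; case: ifPn => // ni; symmetry.
apply: fsfun_dflt; apply: contra ni => fi; apply/imfsetP.
by exists (i - n)%R => //=; rewrite addrC subrK.
Qed.

Lemma shift0 f : shift 0 f = f.
Proof. by apply/fsfunP => i; rewrite shiftE subr0. Qed.
Lemma shiftD m n f : shift (m + n) f = shift m (shift n f).
Proof. by apply/fsfunP => i; rewrite !shiftE opprD addrA. Qed.
Lemma shiftM n : {morph shift n : f g / f * g}.
Proof. by move=> f g; apply/fsfunP => i; rewrite !(shiftE, dsumZME). Qed.
Lemma shift1 n : shift n 1 = 1.
Proof. by apply/fsfunP => i; rewrite !(shiftE, dsumZ1E). Qed.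

End DirectSum.

(* The wreath product of A by the integers, as the semidirect product of
   [dsumZ A] and the additive group of integers acting by [shift]. *)
Definition wreathZ (A : groupType) : Type := (dsumZ A * int)%type.

Section Wreath.
Variable A : groupType.
Implicit Types u v w : wreathZ A.

HB.instance Definition _ := Choice.on (wreathZ A).

Definition wr_one : wreathZ A := (1, 0%R).
Definition wr_mul u v : wreathZ A := (u.1 * shift u.2 v.1, (u.2 + v.2)%R).
Definition wr_inv u : wreathZ A := (shift (- u.2)%R u.1^-1, (- u.2)%R).

Fact wr_mulA : associative wr_mul.
Proof.
by move=> u v w; rewrite /wr_mul /= shiftM shiftD mulgA addrA.
Qed.
Fact wr_mul1 : left_id wr_one wr_mul.
Proof. by case=> f n; rewrite /wr_mul /= shift0 mul1g add0r. Qed.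
Fact wr_mulr1 : right_id wr_one wr_mul.
Proof. by case=> f n; rewrite /wr_mul /= shift1 mulg1 addr0. Qed.
Fact wr_mulV : left_inverse wr_one wr_inv wr_mul.
Proof.
by case=> f n; rewrite /wr_mul /= -shiftM mulVg shift1 addNr.
Qed.
Fact wr_mulrV : right_inverse wr_one wr_inv wr_mul.
Proof.
by case=> f n; rewrite /wr_mul /= -shiftD addrN shift0 mulgV.
Qed.

HB.instance Definition _ := isGroup.Build (wreathZ A)
  wr_mulA wr_mul1 wr_mulr1 wr_mulV wr_mulrV.

End Wreath.

(* Main.v *)
Require Import Defs.
From HB Require Import structures.
From mathcomp Require Import all_boot all_order all_algebra.
From mathcomp Require Import finmap.
From mathcomp Require Import boolp classical_sets functions cardinality.

(** Polycyclic groups, and hence almost polycyclic ones, satisfy the ascending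
    chain condition on subgroups.  The wreath product does not: the subgroups of
    the direct sum consisting of the functions supported in [[-n, n]] form a
    strictly increasing chain as soon as [A] is nontrivial. *)

Set Implicit Arguments.
Unset Strict Implicit.
Unset Printing Implicit Defensive.

Import Order.TTheory GRing.Theory Num.Theory.

Local Open Scope classical_set_scope.
Local Open Scope group_scope.

Definition ascending (T : Type) (Q : nat -> set T) : Prop :=
  forall m n, (m <= n)%N -> Q m `<=` Q n.

(** Each point of [F] that is ever reached has a first stage in the chain; as [F] is finite, the
    maximum of such stages serves as [N]. *)
Lemma ascending_finite_stable (T : choiceType) (F : set T) (Q : nat -> set T) :
  finite_set F -> ascending Q -> exists N, forall n, F `&` Q n `<=` Q N.
Proof.
move=> /finite_seqP[s ->] asc; elim: s => [|c s [N IHs]].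
  by exists 0%N => n x [].
have [[k Qkc]|noc] := pselect (exists k, Q k c).
  exists (maxn k N) => n x [/=]; rewrite inE => /orP[/eqP-> _|xs Qx].
    exact: asc (leq_maxl k N) _ Qkc.
  exact: asc (leq_maxr k N) _ (IHs n x (conj xs Qx)).
exists N => n x [/=]; rewrite inE => /orP[/eqP-> Qc|xs Qx].
  by case: noc; exists n.
exact: IHs n x (conj xs Qx).
Qed.

(** The least positive integer [d] occurring in any [J n] divides every element of every [J n], so
    the chain is constant from a stage containing [d]. *)
Lemma ascending_int_stable (J : nat -> set int) :
  (forall n, J n 0%R) -> (forall n x y, J n x -> J n y -> J n (x - y)%R) ->
  ascending J -> exists N, forall n, J n `<=` J N.
Proof.
move=> J0 JB asc.
have JN n x : J n x -> J n (- x)%R by move=> Jx; rewrite -sub0r; apply: JB.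
have JD n x y : J n x -> J n y -> J n (x + y)%R.
  by move=> Jx Jy; rewrite -[y]opprK; apply: JB => //; apply: JN.
have JMn n x k : J n x -> J n (x *+ k)%R.
  by move=> Jx; elim: k => [|k IHk]; rewrite ?mulr0n // mulrS; apply: JD.
have JM n x (k : int) : J n x -> J n (k * x)%R.
  move=> Jx; case: k => k; first by rewrite -[Posz k]natz mulr_natl; apply: JMn.
  by rewrite NegzE mulNr -[Posz _]natz mulr_natl; apply/JN/JMn.
pose p : pred nat := fun d => `[< (0 < d)%N /\ exists n, J n (Posz d) >].
have [exd|nod] := pselect (exists d, p d); last first.
  (* Without a positive element, every [J n] is zero, since a nonzero [x] would yield its absolute
     value. *)
  exists 0%N => n x Jx; have [->|x0] := eqVneq x 0%R; first exact: J0.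
  case: nod; exists `|x|%N; apply/asboolP; split; first by rewrite absz_gt0.
  by exists n; rewrite abszE; case: (ger0P x) => // _; apply: JN.
have [d /asboolP[d_gt0 [N JNd]] dmin] := ex_minnP exd.
exists N => n x Jx.
have d_neq0 : Posz d != 0%R by rewrite eqz_nat -lt0n.
suff xd : (x %% d)%Z = 0%R by rewrite (divz_eq x d) xd addr0; apply: JM.
(* [x] and [d] may come from different stages; the remainder lives in the later one and, being less
   than [d], vanishes by minimality. *)
have Jmod : J (maxn n N) (x %% d)%Z.
  rewrite /modz; apply: JB; first exact: asc (leq_maxl n N) _ Jx.
  by apply: JM; apply: asc (leq_maxr n N) _ JNd.
have := modz_ge0 x d_neq0; have := ltz_mod x d_neq0.
case: (x %% d)%Z Jmod => // r Jr; rewrite /= ltz_nat => ltrd _.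
case: (posnP r) => [->//|r_gt0].
suff /dmin : p r by rewrite leqNgt ltrd.
by apply/asboolP; split=> //; exists (maxn n N).
Qed.

Section AscendingChains.
Variable G : groupType.
Implicit Types (P H K : set G) (x y : G).

Definition subgroup_chain (C : nat -> set G) : Prop :=
  (forall n, subgroup (C n)) /\ ascending C.

(* For a subgroup P this is equivalent to the usual condition on the chains of
   subgroups of P; letting the chains run through G avoids restricting them. *)
Definition acc P : Prop :=
  forall C, subgroup_chain C -> exists N, forall n, P `&` C n `<=` C N.

Lemma lcosetP H x y : subgroup H -> lcoset H x = lcoset H y -> H (y^-1 * x).
Proof.
move=> [H1 _ _] eqxy.
have : lcoset H y x by rewrite -eqxy; exists 1; rewrite ?mulg1.
by case=> h Hh <-; rewrite mulKg.
Qed.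

(** Both the traces [P] meets [C n] and the finite sets of cosets met by [C n] stabilize. Then [x]
    in [C n] shares its coset with some [y] already in the stable stage, and [y^-1 * x] falls in the
    stable trace. *)
Lemma acc_of_finite_index P :
  subgroup P -> finite_index P -> acc P -> acc [set: G].
Proof.
move=> sgP finP accP C chC; have [sgC ascC] := chC.
have [N1 stabP] := accP C chC.
pose Q n : set (set G) := [set lcoset P x | x in C n].
have ascQ : ascending Q.
  by move=> m n lemn _ [x Cx <-]; exists x => //; apply: ascC lemn _ Cx.
have [N2 stabQ] := ascending_finite_stable finP ascQ.
exists (maxn N1 N2) => n x [_ Cx].
have [|y CNy eqyx] := stabQ n (lcoset P x).
  by split; [exists x|exists x].
have Cy : C (maxn N1 N2) y by apply: ascC (leq_maxr _ _) _ CNy.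
have Py := lcosetP sgP (esym eqyx).
have [_ CM _] := sgC (maxn N1 N2).
rewrite -[x](mulVKg y); apply: CM => //; apply: (ascC _ _ (leq_maxl _ _)).
apply: (stabP (maxn n (maxn N1 N2))); split=> //.
have [_ CM' CV'] := sgC (maxn n (maxn N1 N2)).
apply: CM'; last exact: ascC (leq_maxl _ _) _ Cx.
by apply: CV'; apply: ascC (leq_maxr _ _) _ Cy.
Qed.

Lemma expgzS x (n : int) : expgz x (n + 1)%R = expgz x n * x.
Proof.
case: n => [n|[|n]]; first by rewrite /= addn1 expgSr.
  by rewrite /= expg1 mulVg.
have -> : (Negz n.+1 + 1)%R = Negz n.
  by rewrite !NegzE (intS n.+1) opprD addrC addrA subrr add0r.
by rewrite /= [x ^+ n.+2]expgS invgM mulgVK.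
Qed.

Lemma expgzD x (m n : int) : expgz x (m + n)%R = expgz x m * expgz x n.
Proof.
elim/int_rect: n => [|n IHn|n IHn]; first by rewrite addr0 mulg1.
  by rewrite intS [(1 + _)%R]addrC addrA !expgzS IHn mulgA.
(* Multiplying by [x] on the right raises both exponents by one, back to the induction
   hypothesis. *)
apply: (@mulIg _ x); rewrite -mulgA -!expgzS -addrA.
have -> : (- Posz n.+1 + 1)%R = (- Posz n)%R.
  by rewrite intS opprD addrC addrA subrr add0r.
by [].
Qed.

Lemma expgzN x (n : int) : expgz x (- n)%R = (expgz x n)^-1.
Proof. by apply: (@mulIg _ (expgz x n)); rewrite -expgzD addNr mulVg. Qed.

Lemma subgroup_expgz K x (n : int) : subgroup K -> K x -> K (expgz x n).
Proof.
move=> [K1 KM KV] Kx.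
have KX m : K (x ^+ m) by elim: m => [//|m IHm]; rewrite expgS; apply: KM.
by case: n => n /=; [|apply: KV].
Qed.

(** The finite-index argument again, with cosets replaced by the exponents [m] for which [C n] meets
    the coset of [x^m]; these form a subgroup of the integers. *)
Lemma acc_cyclic_extension H K :
  normal_in H K -> cyclic_quotient K H -> acc H -> acc K.
Proof.
move=> [sgH sgK sHK nHK] [x Kx quoKH] accH C chC; have [sgC ascC] := chC.
have [H1 HM HV] := sgH.
have [N1 stabH] := accH C chC.
pose J n : set int := [set m | exists2 h, H h & C n (expgz x m * h)].
have [||p q leqpq m [h Hh Ch]|N2 stabJ] := @ascending_int_stable J.
- by move=> n; exists 1 => //; rewrite mulg1; have [] := sgC n.
- move=> n p q [h Hh Ch] [k Hk Ck]; have [_ CM CV] := sgC n.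
  (* From [(x^p h) (x^q k)^-1 = x^(p-q) (x^q h k^-1 x^-q)]; normality keeps the last factor in
     [H]. *)
  exists ((h * k^-1) ^ (expgz x q)^-1).
    apply: nHK; first by apply: HM => //; apply: HV.
    by have [_ _ KV] := sgK; apply: KV; apply: subgroup_expgz.
  have := CM _ _ Ch (CV _ Ck).
  by rewrite expgzD expgzN conjgE invgK invgM !mulgA mulgVK.
- by exists h => //; apply: ascC leqpq _ Ch.
exists (maxn N1 N2) => n y [Ky Cy].
have : quotient K H (lcoset H y) by exists y.
rewrite quoKH => -[m _ /esym/(lcosetP sgH) Hy].
have /stabJ[h Hh CNh] : J n m by exists ((expgz x m)^-1 * y) => //; rewrite mulVKg.
(* [z] is a representative of the coset of [y] taken from the stable stage; it need not equal
   [y]. *)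
set z := expgz x m * h in CNh.
have Cz : C (maxn N1 N2) z by apply: ascC (leq_maxr _ _) _ CNh.
have [_ CM _] := sgC (maxn N1 N2).
rewrite -[y](mulVKg z); apply: CM => //; apply: (ascC _ _ (leq_maxl _ _)).
apply: (stabH (maxn n (maxn N1 N2))); split.
  by rewrite /z invgM -mulgA; apply: HM => //; apply: HV.
have [_ CM' CV'] := sgC (maxn n (maxn N1 N2)).
apply: CM'; last exact: ascC (leq_maxl _ _) _ Cy.
by apply: CV'; apply: ascC (leq_maxr _ _) _ Cz.
Qed.

Lemma acc_polycyclic P : polycyclic P -> acc P.
Proof.
move=> [k [S [S0 <- stepS]]].
suff: forall i, (i <= k)%N -> acc (S i) by apply.
elim=> [_ C [sgC _]|i IHi ltik].
  (* The trivial group lies in every member of the chain. *)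
  by exists 0%N => n x [+ _]; rewrite S0 => ->; have [] := sgC 0%N.
by have [nS cS] := stepS i ltik; apply: acc_cyclic_extension nS cS (IHi (ltnW ltik)).
Qed.

Lemma acc_almost_polycyclic : almost_polycyclic G -> acc [set: G].
Proof.
by move=> [P [sgP polyP finP]]; apply: acc_of_finite_index (acc_polycyclic polyP).
Qed.

End AscendingChains.

Definition base_interval (A : groupType) (n : nat) : set (wreathZ A) :=
  [set u : wreathZ A | u.2 = 0%R /\ forall i, (n < `|i|)%N -> u.1 i = 1].

Lemma base_interval_chain (A : groupType) : subgroup_chain (@base_interval A).
Proof.
split=> [n|m n lemn u [u2 u1]]; last first.
  by split=> // i ltni; apply: u1; apply: leq_ltn_trans ltni.
split=> [|[f _] [g _] [/= -> f1] [/= -> g1]|[f _] [/= -> f1]].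
- by split=> // i _; rewrite dsumZ1E.
- by split=> //= i ltni; rewrite shift0 dsumZME f1 // g1 // mulg1.
- by split=> /= [|i ltni]; rewrite oppr0 // shift0 dsumZVE f1 // invg1.
Qed.

Theorem mainTheorem3 (A : groupType)
    (A_abelian : forall x y : A, (x * y = y * x)%g)
    (A_fg : finitely_generated A)
    (A_nontrivial : exists a : A, a <> 1%g) :
  ~ almost_polycyclic (wreathZ A).
Proof.
case: A_nontrivial => a a1 /acc_almost_polycyclic accW.
have [N stab] := accW _ (@base_interval_chain A).
(* Supported exactly at [N.+1], so in stage [N.+1] of the chain but not in stage [N]. *)
pose f : dsumZ A := [fsfun i in [fset (Posz N.+1)]%fset => a].
have fE i : f i = if i == Posz N.+1 then a else 1 by rewrite fsfunE in_fset1.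
have [|_ /(_ (Posz N.+1))] := stab N.+1 (f, 0%R : int).
  split=> //; split=> //= i ltNi; rewrite fE; case: eqP => // i_eq.
  by rewrite i_eq ltnn in ltNi.
by rewrite /= fE eqxx => /(_ (ltnSn N)).
Qed.
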